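(* Let $\Theta\subseteq\mathbb{R}^d$, $f:\Theta\to\mathbb{R}$, and let $\pi=Z^{-1}\exp(-f)$ be a probability density on $\Theta$ with normalizing constant $Z$. Let $A(\cdot)$ be the acceptance probability of the random walk Metropolis-Hastings (RWMH) kernel targeting $\pi$ with Gaussian proposal $N(\theta,hI_d)$, $h\in(0,\infty)$. Suppose $\Theta$ is convex and that, for $\xi\in(0,\infty)$, $f$ is $\xi^{-1}$-strongly convex on $\Theta$. If $\theta_0\in\Theta$, then, for any $v\in\partial f(\theta_0)$, $$A(\theta_0)\ \le\ \frac{1}{(1+h/\xi)^{d/2}}\exp\left\{\frac h2\left(\frac{1}{1+h/\xi}\right)\|v\|_2^2\right\}.$$
   Context: The density $\pi$ is with respect to Lebesgue measure on $\mathbb{R}^d$ (and is zero off $\Theta$). With $q(\theta,\cdot)$ the density of $N(\theta,hI_d)$, the RWMH acceptance probability is $A(\theta)=\int\left[\frac{\pi(\theta')}{\pi(\theta)}\wedge1\right]q(\theta,\theta')\,d\theta'$ for $\theta\in\Theta$. For a convex set $S$, $f$ is $\xi^{-1}$-strongly convex on $S$ if $\theta\mapsto f(\theta)-\|\theta\|_2^2/(2\xi)$ is convex on $S$. $\partial f(\theta)$ is the set of subgradients of $f$ at $\theta$. *)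

(* Defs.v *)
From HB Require Import structures.
From mathcomp Require Import all_boot all_order all_algebra.
From mathcomp Require Import all_classical all_reals all_analysis.

Set Implicit Arguments.
Unset Strict Implicit.
Unset Printing Implicit Defensive.

Import Order.TTheory GRing.Theory Num.Theory.
Import numFieldNormedType.Exports.

Local Open Scope classical_set_scope.
Local Open Scope ring_scope.

Definition rV_coord (R : realType) (d : nat) (i : 'I_d) (x : 'rV[R]_d) : R :=
  x ord0 i.

Definition rV_display : measure_display.
Proof. exact: default_measure_display. Qed.

(* The Borel sigma-algebra of R^d, presented as the one generated by the
   coordinate maps (as the library does for n.-tuple). *)
Section rV_measurable.
Context {R : realType} {d : nat}.

Let rV_set0 : g_sigma_preimage (@rV_coord R d) set0.
Proof. exact: sigma_algebra0. Qed.

Let rV_setC A : g_sigma_preimage (@rV_coord R d) A ->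
  g_sigma_preimage (@rV_coord R d) (~` A).
Proof. exact: sigma_algebraC. Qed.

Let rV_bigcup (F : _^nat) :
  (forall i, g_sigma_preimage (@rV_coord R d) (F i)) ->
  g_sigma_preimage (@rV_coord R d) (\bigcup_i (F i)).
Proof. exact: sigma_algebra_bigcup. Qed.

HB.instance Definition _ := @isMeasurable.Build rV_display
  'rV[R]_d (g_sigma_preimage (@rV_coord R d)) rV_set0 rV_setC rV_bigcup.

End rV_measurable.

Lemma measurable_rV_coord (R : realType) (d : nat) (i : 'I_d) :
  measurable_fun setT (@rV_coord R d i).
Proof.
move=> _ Y mY; rewrite setTI; apply: sub_sigma_algebra => /=.
rewrite -bigcup_seq/=; exists i => /=; first by rewrite mem_index_enum.
by exists Y => //; rewrite setTI.
Qed.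

Lemma measurable_fun_rVP d1 (T : measurableType d1) (R : realType) (d : nat)
    (f : T -> 'rV[R]_d) :
  (forall i, measurable_fun setT (@rV_coord R d i \o f)) ->
  measurable_fun setT f.
Proof.
move=> mf.
have prefS : g_sigma_preimage (fun i => @rV_coord R d i \o f) `<=` measurable.
  apply: smallest_sub; first exact: sigma_algebra_measurable.
  case: d => [|n] in f mf *; first by rewrite big_ord0.
  rewrite -bigcup_mkord_ord; apply: bigcup_sub => i Ii.
  by move=> A [B mB <-]; exact: mf.
by rewrite g_sigma_preimage_comp in prefS; move=> _ A mA; apply: prefS; exists A.
Qed.

Definition rV_cons (R : realType) (d : nat) (p : measurableTypeR R * 'rV[R]_d) :
  'rV[R]_d.+1 := row_mx (p.1 : R)%:M p.2.

Definition rV_uncons (R : realType) (d : nat) (x : 'rV[R]_d.+1) :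
  measurableTypeR R * 'rV[R]_d := (x ord0 ord0, \row_i x ord0 (lift ord0 i)).

Lemma rV_cons0 (R : realType) (d : nat) (p : measurableTypeR R * 'rV[R]_d) :
  rV_cons p ord0 ord0 = p.1.
Proof.
have -> : (ord0 : 'I_d.+1) = lshift d (ord0 : 'I_1) by exact: val_inj.
by rewrite [LHS](@row_mxEl _ 1 1 d) mxE.
Qed.

Lemma rV_consS (R : realType) (d : nat) (p : measurableTypeR R * 'rV[R]_d) i :
  rV_cons p ord0 (lift ord0 i) = p.2 ord0 i.
Proof.
have -> : lift (ord0 : 'I_d.+1) i = rshift 1 i by exact: val_inj.
by rewrite [LHS](@row_mxEr _ 1 1 d).
Qed.

Lemma rV_consK (R : realType) (d : nat) : cancel (@rV_cons R d) (@rV_uncons R d).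
Proof.
move=> [a x]; rewrite /rV_uncons rV_cons0; congr pair.
by apply/rowP => i; rewrite mxE rV_consS.
Qed.

Lemma rV_unconsK (R : realType) (d : nat) : cancel (@rV_uncons R d) (@rV_cons R d).
Proof.
move=> x; apply/rowP => i; rewrite -[0]/ord0.
have [j ->|->] := unliftP ord0 i; first by rewrite rV_consS mxE.
by rewrite rV_cons0.
Qed.

Lemma measurable_rV_cons (R : realType) (d : nat) :
  measurable_fun setT (@rV_cons R d).
Proof.
apply: measurable_fun_rVP => i.
have [j ->|->] := unliftP ord0 i.
  rewrite (_ : _ \o _ = @rV_coord R d j \o snd).
    by apply: measurableT_comp => //; exact: measurable_rV_coord.
  by apply/funext => p /=; rewrite /rV_coord rV_consS.
rewrite (_ : _ \o _ = fst); first exact: measurable_fst.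
by apply/funext => p /=; rewrite /rV_coord rV_cons0.
Qed.

Lemma measurable_rV_uncons (R : realType) (d : nat) :
  measurable_fun setT (@rV_uncons R d).
Proof.
apply: measurable_fun_pair; first exact: (@measurable_rV_coord R d.+1 ord0).
apply: measurable_fun_rVP => i.
rewrite (_ : _ \o _ = @rV_coord R d.+1 (lift ord0 i)).
  exact: measurable_rV_coord.
by apply/funext => x /=; rewrite /rV_coord mxE.
Qed.

Section lebesgue_rV_step.
Local Open Scope ereal_scope.
Context {R : realType} {d : nat}.
Context (mu : {sigma_finite_measure set 'rV[R]_d -> \bar R}).

Definition lebesgue_rV_step : set 'rV[R]_d.+1 -> \bar R :=
  pushforward (lebesgue_measure \x mu) (@rV_cons R d).

Let step0 : lebesgue_rV_step set0 = 0.
Proof. by rewrite /lebesgue_rV_step /pushforward preimage_set0 measure0. Qed.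

Let step_ge0 A : 0 <= lebesgue_rV_step A.
Proof. exact: (measure_ge0 (lebesgue_measure \x mu)). Qed.

Let step_sigma_additive : semi_sigma_additive lebesgue_rV_step.
Proof.
move=> F mF tF mUF; rewrite /lebesgue_rV_step /pushforward preimage_bigcup.
have mpre B : measurable B -> measurable (@rV_cons R d @^-1` B).
  by move=> mB; rewrite -[X in measurable X]setTI; exact: measurable_rV_cons.
apply: measure_semi_sigma_additive.
- by move=> n; exact: mpre.
- apply/trivIsetP => /= i j _ _ ij; rewrite -preimage_setI.
  by move/trivIsetP : tF => /(_ _ _ _ _ ij) ->//; rewrite preimage_set0.
- by rewrite -preimage_bigcup; exact: mpre.
Qed.

HB.instance Definition _ := isMeasure.Build _ _ _ lebesgue_rV_step
  step0 step_ge0 step_sigma_additive.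

Let step_sigma_finite : sigma_finite setT lebesgue_rV_step.
Proof.
have /sigma_finiteP[F [FT ndF Foo]] := sigma_finiteT (@lebesgue_measure R).
have /sigma_finiteP[G [GT ndG Goo]] := sigma_finiteT mu.
exists (fun k => @rV_uncons R d @^-1` (F k `*` G k)).
  rewrite -preimage_bigcup; apply/esym/seteqP; split => // x _.
  have [n _ Fn] : (\bigcup_n F n) (rV_uncons x).1 by rewrite -FT.
  have [k _ Gk] : (\bigcup_n G n) (rV_uncons x).2 by rewrite -GT.
  exists (maxn n k) => //; split.
    by move: Fn; exact/subsetPset/ndF/leq_maxl.
  by move: Gk; exact/subsetPset/ndG/leq_maxr.
move=> k; have [mF Fk] := Foo k; have [mG Gk] := Goo k; split.
  rewrite -[X in measurable X]setTI.
  by apply: (measurable_rV_uncons measurableT); exact: measurableX.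
rewrite /lebesgue_rV_step /pushforward -comp_preimage.
rewrite (_ : _ \o _ = id) ?preimage_id; last first.
  by apply/funext => p /=; rewrite rV_consK.
by rewrite product_measure1E// lte_mul_pinfty// ge0_fin_numE.
Qed.

HB.instance Definition _ := Measure_isSigmaFinite.Build _ _ _ lebesgue_rV_step
  step_sigma_finite.

End lebesgue_rV_step.

(* d-dimensional Lebesgue measure: the d-fold product of the one-dimensional
   one (the point mass when d = 0). *)
Fixpoint lebesgue_rV (R : realType) (d : nat) :
    {sigma_finite_measure set 'rV[R]_d -> \bar R} :=
  match d with
  | 0%N => dirac (0 : 'rV[R]_0)
  | d'.+1 => lebesgue_rV_step (lebesgue_rV R d')
  end.

Lemma lebesgue_rV_box (R : realType) (d : nat) (A : 'I_d -> set R) :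
  (forall i, measurable (A i)) ->
  lebesgue_rV R d [set x | forall i, A i (x ord0 i)] =
  (\prod_(i < d) lebesgue_measure (A i))%E.
Proof.
elim: d => [|d IH] in A *; move=> mA.
  by rewrite big_ord0 /= diracE mem_set// => -[].
rewrite big_ord_recl -(IH (A \o lift ord0))//=.
rewrite /lebesgue_rV_step /pushforward -product_measure1E//.
  congr (_ _); apply/seteqP; split => p /=.
    move=> H; split; first by have := H ord0; rewrite rV_cons0.
    by move=> i; have := H (lift ord0 i); rewrite rV_consS.
  move=> [p1 p2] i; have [j ->|->] := unliftP ord0 i.
    by rewrite rV_consS; exact: p2.
  by rewrite rV_cons0.
  exact: mA.
suff -> : (fun x : 'rV[R]_d => forall i, A (lift ord0 i) (x ord0 i)) =
    \bigcap_(i in setT) (@rV_coord R d i @^-1` A (lift ord0 i)).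
  apply: fin_bigcap_measurable => // i _; rewrite -[X in measurable X]setTI.
  by apply: (measurable_rV_coord _ measurableT); exact: mA.
by apply/seteqP; split => x H i => [_|]; exact: H.
Qed.

Definition dot (R : realType) (d : nat) (x y : 'rV[R]_d) : R :=
  \sum_(i < d) x ord0 i * y ord0 i.

(* Euclidean norm; the norm `|x| of the library on 'rV is the sup norm. *)
Definition norm2 (R : realType) (d : nat) (x : 'rV[R]_d) : R :=
  Num.sqrt (dot x x).

Definition strongly_convex (R : realType) (d : nat) (c : R) (S : set 'rV[R]_d)
    (f : 'rV[R]_d -> R) : Prop :=
  convex_function S (fun x => f x - c / 2 * norm2 x ^+ 2).

Definition subdifferential (R : realType) (d : nat) (S : set 'rV[R]_d)
    (f : 'rV[R]_d -> R) (x : 'rV[R]_d) : set 'rV[R]_d :=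
  [set v | forall y, S y -> f x + dot v (y - x) <= f y].

(* Measurability is meant in the sense of Lebesgue, i.e. up to a null set: the
   target may be supported on a convex set which is not Borel. As the integral
   of a nonnegative function is the supremum of the integrals of the simple
   functions below it, it is then the Lebesgue integral. *)
Definition probability_density (R : realType) (d : nat) (p : 'rV[R]_d -> R) :
    Prop :=
  [/\ exists2 g : 'rV[R]_d -> R, measurable_fun setT g &
        {ae lebesgue_rV R d, forall x, p x = g x},
      forall x, 0 <= p x &
      (\int[lebesgue_rV R d]_x (p x)%:E = 1)%E].

Definition gibbs_density (R : realType) (d : nat) (S : set 'rV[R]_d)
    (f : 'rV[R]_d -> R) (Z : R) : 'rV[R]_d -> R :=
  (fun x => Z^-1 * expR (- f x)) \_ S.

(* Density at y of the Gaussian N(x, h I_d). *)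
Definition gaussian_proposal (R : realType) (d : nat) (h : R)
    (x y : 'rV[R]_d) : R :=
  (2 * pi * h) `^ (- (d%:R / 2)) * expR (- (norm2 (y - x) ^+ 2 / (2 * h))).

Definition rwmh_acceptance (R : realType) (d : nat) (p : 'rV[R]_d -> R) (h : R)
    (x : 'rV[R]_d) : \bar R :=
  (\int[lebesgue_rV R d]_y
     (Num.min (p y / p x) 1 * gaussian_proposal h x y)%:E)%E.

(* Main.v *)
Require Import Defs.
From mathcomp Require Import all_boot all_order all_algebra.
From mathcomp Require Import all_classical all_reals all_analysis.
From mathcomp Require Import measurable_realfun.
From mathcomp Require Import ring lra.

Import Order.TTheory GRing.Theory Num.Theory.
Import numFieldNormedType.Exports.
Local Open Scope classical_set_scope.
Local Open Scope ring_scope.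

(** Bound the acceptance ratio by its first argument.  Strong convexity
    sharpens the subgradient inequality at [theta0] by a quadratic term:
    [f y - f theta0 >= <v, y - theta0> + |y - theta0|^2 / (2 xi)]
    ([strongly_convex_subgradient]).  Hence
    [pi y / pi theta0 <= exp (- <v, y - theta0> - |y - theta0|^2 / (2 xi))]:
    on [Theta] by this inequality and off [Theta] because the left-hand side
    vanishes ([gibbs_density_ratio]).

    Multiplying by the Gaussian proposal leaves the exponential of a quadratic
    polynomial without cross terms in the coordinates, so its integral is a
    product of one-dimensional ones ([integral_rV_prod], an iteration of the
    Tonelli theorem).  Completing the square turns each factor into a constant
    times a normal density of variance [(1/h + 1/xi)^-1 = h / (1 + h/xi)]
    ([integral_tilted_gaussian]); the product of these constants is the bound
    ([integral_tilted_gaussian_rV]). *)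

(** The target density is measurable only up to a null set, so the integrand of
    the acceptance probability need not be measurable.  Monotonicity survives:
    the integral of a nonnegative function is a supremum over the simple
    functions below it. *)
Lemma ge0_le_integral_nonmeasurable (d : measure_display)
    (T : measurableType d) (R : realType) (mu : {measure set T -> \bar R})
    (f g : T -> \bar R) :
  (forall x, 0 <= f x)%E -> (forall x, f x <= g x)%E ->
  (\int[mu]_x f x <= \int[mu]_x g x)%E.
Proof.
move=> f0 fg; have g0 x : (0 <= g x)%E by apply: le_trans (f0 x) (fg x).
rewrite !ge0_integralTE//; apply: ereal_sup_le => _ [s /= sf <-].
by exists s => //= x; exact: le_trans (sf x) (fg x).
Qed.

(** This is where Lebesgue measure on [R^d], an iterated product, meets
    one-dimensional integrals: each step of the induction on [d] splits off the
    first coordinate by the Tonelli theorem. *)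
Lemma integral_rV_prod (R : realType) (d : nat) (g : 'I_d -> R -> R) :
  (forall i, measurable_fun setT (g i)) -> (forall i x, 0 <= g i x) ->
  (\int[lebesgue_rV R d]_x (\prod_(i < d) g i (x ord0 i))%:E =
   \prod_(i < d) \int[lebesgue_measure]_t (g i t)%:E)%E.
Proof.
elim: d g => [|d IH] g mg g0.
  under eq_integral do rewrite big_ord0.
  by rewrite big_ord0 /= integral_dirac// diracT mul1e.
have mprod n (k : 'I_n -> R -> R) : (forall i, measurable_fun setT (k i)) ->
    measurable_fun setT
      (EFin \o (fun x : 'rV[R]_n => \prod_(i < n) k i (x ord0 i))).
  move=> mk; apply/measurable_EFinP/measurable_prod => i _.
  by apply: measurableT_comp (mk i) _; exact: measurable_rV_coord.
rewrite /= /lebesgue_rV_step ge0_integral_pushforward//; first last.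
- by move=> x _; rewrite lee_fin prodr_ge0.
- exact: mprod.
- exact: measurable_rV_cons.
rewrite preimage_setT.
rewrite fubini_tonelli1; first last.
- by move=> x /=; rewrite lee_fin prodr_ge0.
- by apply: measurableT_comp (mprod _ _ mg) _; exact: measurable_rV_cons.
rewrite big_ord_recl -IH//.
rewrite -ge0_integralZr//; first last.
- by apply: integral_ge0 => x _; rewrite lee_fin prodr_ge0.
- by move=> t _; rewrite lee_fin.
- by have /measurable_EFinP := mg ord0; exact.
apply: eq_integral => t _; rewrite /fubini_F -ge0_integralZl//; first last.
- by rewrite lee_fin.
- by move=> x _; rewrite lee_fin prodr_ge0.
- by apply: (mprod _ (fun i => g (lift ord0 i))) => i.
apply: eq_integral => x _ /=; rewrite -EFinM big_ord_recl rV_cons0.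
by congr (_ * _)%:E; apply: eq_bigr => i _; rewrite rV_consS.
Qed.

Lemma norm2_sqr (R : realType) (d : nat) (x : 'rV[R]_d) :
  norm2 x ^+ 2 = \sum_(i < d) x ord0 i ^+ 2.
Proof.
rewrite sqr_sqrtr; first by apply: eq_bigr => i _; rewrite expr2.
by apply: sumr_ge0 => i _; rewrite -expr2 sqr_ge0.
Qed.

Lemma norm2_sqr_conv (R : realType) (d : nat) (t : R) (x u : 'rV[R]_d) :
  norm2 (x + t *: u) ^+ 2 =
  t * norm2 (x + u) ^+ 2 + (1 - t) * norm2 x ^+ 2
  - t * (1 - t) * norm2 u ^+ 2.
Proof.
rewrite !norm2_sqr !mulr_sumr -big_split -sumrB; apply: eq_bigr => i _ /=.
by rewrite !mxE; ring.
Qed.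

(** Compare [f] at [x + t (y - x)] with its chord above and with the subgradient
    below, and divide by [t]: the gap [f y - f x - <v, y - x>] is at least
    [(1 - t) * c / 2 * |y - x|^2] for every [t] in the open unit interval.
    Then [t] tends to 0. *)
Lemma strongly_convex_subgradient (R : realType) (d : nat) (c : R)
    (S : set 'rV[R]_d) (f : 'rV[R]_d -> R) (x v y : 'rV[R]_d) :
  convex_set S -> strongly_convex c S f ->
  subdifferential S f x v -> S x -> S y ->
  f x + dot v (y - x) + c / 2 * norm2 (y - x) ^+ 2 <= f y.
Proof.
move=> Scvx fcvx fv Sx Sy; set u := y - x.
have Ey : y = x + u by rewrite addrC subrK.
set K := c / 2 * norm2 u ^+ 2; set D := f y - f x - dot v u.
have tD t : 0 < t -> t < 1 -> (1 - t) * K <= D.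
  move=> t0 t1.
  pose p : {i01 R} := Itv01 (ltW t0) (ltW t1).
  have zE : conv p (y : convex_lmodType _) (x : convex_lmodType _)
      = x + t *: u.
    rewrite /conv/= /unstable.onem /u scalerBr scalerBl scale1r.
    by rewrite addrCA addrA.
  have Sz : S (x + t *: u).
    by rewrite -zE; apply/set_mem/Scvx; exact/mem_set.
  have := fcvx p y x (mem_set Sy) (mem_set Sx).
  rewrite zE convRE /= /unstable.onem norm2_sqr_conv -Ey => Hc.
  have := fv _ Sz; rewrite [x + t *: u - x]addrC addKr.
  have -> : dot v (t *: u) = t * dot v u.
    by rewrite /dot mulr_sumr; apply: eq_bigr => i _; rewrite mxE mulrCA.
  move=> Hs; rewrite -(ler_pM2l t0) /D /K.
  move: Hc Hs; nra.
suff : K <= D by rewrite /D; lra.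
rewrite leNgt; apply/negP => DK.
have [D0|D0] := leP D 0.
  have := tD (1/2); lra.
have Kp : 0 < K by exact: lt_trans DK.
have K2 : 0 < 2 * K by rewrite mulr_gt0.
(* [t = (K - D) / (2 * K)] puts [(1 - t) * K] halfway between [D] and [K]. *)
have t0 : 0 < (K - D) / (2 * K) by rewrite divr_gt0 ?subr_gt0.
have t1 : (K - D) / (2 * K) < 1 by rewrite ltr_pdivrMr//; lra.
have := tD _ t0 t1.
have -> : (1 - (K - D) / (2 * K)) * K = (K + D) / 2.
  by field; rewrite gt_eqF.
lra.
Qed.

(** Multiplying the density of [N(m, h)] by [exp (- v u - u^2 / (2 xi))], with
    [u = t - m], adds precisions and shifts the mean: up to a constant factor
    it is the density of [N(m - s^2 v, s^2)] with [s^-2 = h^-1 + xi^-1]. *)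
Lemma integral_tilted_gaussian (R : realType) (h xi m v : R) :
  0 < h -> 0 < xi ->
  (\int[lebesgue_measure]_t
     ((2 * pi * h) `^ (- 2^-1) *
      expR (- (t - m) ^+ 2 / (2 * h) - v * (t - m)
            - xi^-1 / 2 * (t - m) ^+ 2))%:E =
   ((1 + h / xi) `^ (- 2^-1) *
    expR (h / 2 * (1 / (1 + h / xi)) * v ^+ 2))%:E)%E.
Proof.
move=> h0 xi0; set k := 1 + h / xi.
have k0 : 0 < k by rewrite addr_gt0// divr_gt0.
pose s := Num.sqrt (h / k).
have s2 : s ^+ 2 = h / k by rewrite sqr_sqrtr// divr_ge0// ltW.
have s0 : s != 0 by rewrite gt_eqF// sqrtr_gt0 divr_gt0.
set C := k `^ _ * _.
have C0 : 0 <= C by rewrite mulr_ge0 ?powR_ge0 ?expR_ge0.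
transitivity (\int[lebesgue_measure]_t
    (C%:E * (normal_pdf (m - s ^+ 2 * v) s t)%:E))%E; last first.
  rewrite ge0_integralZl//=.
  - by rewrite integral_normal_pdf mule1.
  - by have /measurable_EFinP := measurable_normal_pdf (m - s ^+ 2 * v) s; exact.
  - by move=> t _; rewrite lee_fin normal_pdf_ge0.
apply: eq_integral => t _; rewrite -EFinM; congr EFin.
rewrite normal_pdfE// /normal_peak /normal_fun /C.
rewrite [RHS]mulrACA -expRD !powRN !powR12_sqrt; last 2 first.
- exact: ltW.
- by rewrite !mulr_ge0 ?pi_ge0// ltW.
congr (_ * expR _).
  rewrite -invfM -sqrtrM ?(ltW k0)// s2; congr (Num.sqrt _)^-1.
  by field; rewrite gt_eqF.
rewrite s2 /k; field.
by rewrite !gt_eqF ?addr_gt0.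
Qed.

Lemma integral_tilted_gaussian_rV (R : realType) (d : nat) (h xi : R)
    (x v : 'rV[R]_d) :
  0 < h -> 0 < xi ->
  (\int[lebesgue_rV R d]_y
     (expR (- (dot v (y - x) + xi^-1 / 2 * norm2 (y - x) ^+ 2)) *
      gaussian_proposal h x y)%:E =
   (1 / (1 + h / xi) `^ (d%:R / 2) *
    expR (h / 2 * (1 / (1 + h / xi)) * norm2 v ^+ 2))%:E)%E.
Proof.
move=> h0 xi0.
have prod_powR (a : R) : a `^ (- (d%:R / 2)) = \prod_(i < d) a `^ (- 2^-1).
  rewrite prodr_const card_ord -powR_mulrn ?powR_ge0// -powRrM.
  by congr powR; rewrite mulNr mulrC.
pose g i t := (2 * pi * h) `^ (- 2^-1) *
  expR (- (t - x ord0 i) ^+ 2 / (2 * h) - v ord0 i * (t - x ord0 i)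
        - xi^-1 / 2 * (t - x ord0 i) ^+ 2).
transitivity (\int[lebesgue_rV R d]_y (\prod_(i < d) g i (y ord0 i))%:E)%E.
  apply: eq_integral => y _; congr EFin.
  rewrite big_split /= -prod_powR /gaussian_proposal mulrCA; congr (_ * _).
  rewrite -expR_sum -expRD; congr expR.
  rewrite !norm2_sqr /dot mulr_sumr mulr_suml -big_split -!sumrN -big_split /=.
  by apply: eq_bigr => i _; rewrite !mxE; ring.
rewrite integral_rV_prod; first last.
- by move=> i t; rewrite mulr_ge0 ?powR_ge0 ?expR_ge0.
- move=> i; apply: measurable_funM => //; apply: measurableT_comp => //.
  have mB : measurable_fun setT (fun t : R => t - x ord0 i).
    exact: measurable_funB.
  apply: measurable_funB; last exact/measurable_funM/measurable_funX.
  apply: measurable_funB; last exact: measurable_funM.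
  by apply: measurable_funM => //; apply/measurable_funN/measurable_funX.
under eq_bigr do rewrite integral_tilted_gaussian//.
rewrite prodEFin big_split /= -prod_powR powRN -expR_sum -mulr_sumr.
by rewrite norm2_sqr [in RHS]mul1r.
Qed.

(** Both normalizing constants cancel.  When [Z = 0] the convention [0^-1 = 0]
    makes both densities zero, and their ratio [0 / 0] is zero as well. *)
Lemma gibbs_density_ratio (R : realType) (d : nat) (S : set 'rV[R]_d)
    (f : 'rV[R]_d -> R) (Z : R) (x y : 'rV[R]_d) (a : R) :
  S x -> (S y -> a <= f y - f x) ->
  gibbs_density S f Z y / gibbs_density S f Z x <= expR (- a).
Proof.
move=> Sx ay; rewrite /gibbs_density !patchE (mem_set Sx).
have [/set_mem /ay {}ay|_] := boolP (y \in S); last by rewrite mul0r expR_ge0.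
have [->|Z0] := eqVneq Z 0; first by rewrite invr0 !mul0r expR_ge0.
rewrite invfM mulrACA divff ?invr_eq0// mul1r -expRN -expRD ler_expR; lra.
Qed.

Theorem proposition3 (R : realType) (d : nat) (Theta : set 'rV[R]_d)
    (f : 'rV[R]_d -> R) (Z h xi : R) (theta0 v : 'rV[R]_d)
    (density : probability_density (gibbs_density Theta f Z))
    (h_gt0 : 0 < h)
    (Theta_convex : convex_set Theta)
    (xi_gt0 : 0 < xi)
    (f_strongly_convex : strongly_convex xi^-1 Theta f)
    (theta0_in : Theta theta0)
    (v_subgradient : subdifferential Theta f theta0 v) :
  (rwmh_acceptance (gibbs_density Theta f Z) h theta0 <=
    (1 / (1 + h / xi) `^ (d%:R / 2) *
     expR (h / 2 * (1 / (1 + h / xi)) * norm2 v ^+ 2))%:E)%E.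
Proof.
have [_ density_ge0 _] := density.
have q_ge0 y : 0 <= gaussian_proposal h theta0 y.
  by rewrite mulr_ge0 ?powR_ge0 ?expR_ge0.
rewrite -(integral_tilted_gaussian_rV _ _ _ _ theta0)//.
apply: ge0_le_integral_nonmeasurable => y; rewrite lee_fin.
  by rewrite mulr_ge0// le_min divr_ge0 ?ler01.
apply: ler_wpM2r => //; rewrite ge_min; apply/orP; left.
apply: gibbs_density_ratio => // Ty.
have := strongly_convex_subgradient _ _ _ _ _ _ _ _ Theta_convex
  f_strongly_convex v_subgradient theta0_in Ty.
by lra.
Qed.
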